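(* Let $f(t)\in\mathbb{F}_2[t]$ be irreducible, $f(t)\neq t$, not self-reciprocal, and $R_f=\mathbb{F}_2[t,t^{-1},f(t)^{-1}]$. Then the group $\mathbf{A}_4(R_f)/Z(\mathbf{U}_4(R_f))$ has property $R_\infty$.
   Context: $\mathbf{A}_4(R)$ is the group of upper triangular $4\times4$ matrices over $R$ with diagonal $(1,u_2,u_3,1)$, $u_2,u_3\in U(R)$; $\mathbf{U}_4(R)$ is its subgroup of upper unitriangular matrices, with centre $Z(\mathbf{U}_4(R))=\{e_{1,4}(r): r\in R\}$ (matrices with $(1,4)$-entry $r$ and other off-diagonal entries zero). A group $G$ has property $R_\infty$ if every $\varphi\in\mathrm{Aut}(G)$ has infinitely many classes under $g\sim xg\varphi(x)^{-1}$. $f$ of degree $m$ is self-reciprocal if $t^mf(1/t)=f(t)$. *)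

(* Defs.v *)
From HB Require Import structures.
From mathcomp Require Import all_boot all_order all_algebra.
From mathcomp Require Export fraction.
Set Implicit Arguments. Unset Strict Implicit. Unset Printing Implicit Defensive.
Import Order.TTheory GRing.Theory Num.Theory.
Local Open Scope ring_scope.

Notation P2 := {poly 'F_2}.
Notation K2 := {fraction P2}.
Definition frac2 (p : P2) : K2 := FracField.tofrac p.

Definition self_reciprocal (f : P2) : Prop :=
  frac2 ('X ^+ (size f).-1) *
    (map_poly (fun c : 'F_2 => frac2 c%:P) f).[(frac2 'X)^-1] = frac2 f.

Definition inRf (f : P2) (x : K2) : Prop :=
  exists (p : P2) (a b : nat), x = frac2 p / frac2 ('X ^+ a * f ^+ b).

Definition unitRf (f : P2) (x : K2) : Prop :=
  inRf f x /\ exists y, inRf f y /\ x * y = 1.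

Definition inA4 (f : P2) (A : 'M[K2]_4) : Prop :=
  (forall i j, inRf f (A i j)) /\
  (forall i j : 'I_4, (j < i)%N -> A i j = 0) /\
  A (inord 0) (inord 0) = 1 /\ A (inord 3) (inord 3) = 1 /\
  unitRf f (A (inord 1) (inord 1)) /\ unitRf f (A (inord 2) (inord 2)).

Definition inZU4 (f : P2) (A : 'M[K2]_4) : Prop :=
  exists r, inRf f r /\ A = 1%:M + r *: delta_mx (inord 0) (inord 3).

Definition qeq (f : P2) (A B : 'M[K2]_4) : Prop := inZU4 f (A *m invmx B).

(* phi : A_4(R_f) -> A_4(R_f) is a lift (on representatives) of an
   automorphism of the quotient group A_4(R_f)/Z(U_4(R_f)). Every automorphism
   of the quotient arises this way (choosing representatives). *)
Definition quot_aut (f : P2) (phi : 'M[K2]_4 -> 'M[K2]_4) : Prop :=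
  (forall A, inA4 f A -> inA4 f (phi A)) /\
  (forall A B, inA4 f A -> inA4 f B -> (qeq f A B <-> qeq f (phi A) (phi B))) /\
  (forall A B, inA4 f A -> inA4 f B -> qeq f (phi (A *m B)) (phi A *m phi B)) /\
  (forall B, inA4 f B -> exists A, inA4 f A /\ qeq f (phi A) B).

Definition twisted (f : P2) (phi : 'M[K2]_4 -> 'M[K2]_4) (A B : 'M[K2]_4) : Prop :=
  exists X, inA4 f X /\ qeq f B (X *m A *m invmx (phi X)).

Definition R_infty_A4modZ (f : P2) : Prop :=
  forall phi, quot_aut f phi ->
    exists g : nat -> 'M[K2]_4, (forall n, inA4 f (g n)) /\
      (forall m n, m <> n -> ~ twisted f phi (g m) (g n)).

(* Main.v *)
Require Import Defs.
From mathcomp Require Import all_boot all_order all_algebra.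
From mathcomp Require Import ring zify.
Set Implicit Arguments. Unset Strict Implicit. Unset Printing Implicit Defensive.
Import Order.TTheory GRing.Theory Num.Theory.
Local Open Scope ring_scope.

(**
Let [R = R_f], [N] the image of the unitriangular matrices in the quotient
group, and [C] the subgroup of [N] where the (2,3)-entry vanishes.  Every
automorphism [psi] preserves [N] (the torsion elements) and [C] (the
centraliser in [N] of [1 + e_12 + e_34], whose image under [psi] is again in
[C]).  Hence it acts on [N / C = R] by an additive bijection [h] with
[h (chi x * r) = chi (psi x) * h r], where [chi = u / v] for the diagonal
[(1, u, v, 1)].  As [R] is spanned by its units, [h / h 1] is a ring
automorphism of [R].  It sends [t] to a unit [tau = t^i f^j]; since
[F_2(tau) = F_2(t)], the order of [tau] at [0] and its degree lie in
[{-1, 0, 1}], which forces [j = 0] because [deg f >= 3].  If [tau = t^-1], then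
[f(1/t)] is a unit, which makes [f] self-reciprocal.  So [tau = t], the
character [chi] is invariant under [psi], and the matrices [diag(1, t^n, 1, 1)]
are pairwise not twisted conjugate.
*)

(** * Order and degree of rational functions *)

(** A valuation of the rational function field, trivial on constants, given on nonzero polynomials
    only so that no infinite value is needed. The last clause is the ultrametric equality for
    distinct values. *)
Definition is_weight (F : fieldType) (w : {poly F} -> int) : Prop :=
  [/\ forall c, c != 0 -> w c%:P = 0,
      forall p q, p != 0 -> q != 0 -> w (p * q) = w p + w q &
      forall p q, p != 0 -> q != 0 -> w p < w q ->
        p + q != 0 /\ w (p + q) = w p].

(** A relation rather than a function, since the presentation [p / q] is not unique; [val_uniq]
    shows that [n] does not depend on it. *)
Definition has_val (F : fieldType) (w : {poly F} -> int)
    (x : {fraction {poly F}}) (n : int) : Prop :=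
  exists p q, [/\ p != 0, q != 0, x = FracField.tofrac p / FracField.tofrac q
    & n = w p - w q].

(** For nonzero [p], [1 - size p] is minus the degree, that is, the order at infinity. *)
Lemma degree_weight (F : fieldType) :
  is_weight (fun p : {poly F} => 1 - (size p)%:Z).
Proof.
split=> [c c0|p q p0 q0|p q p0 q0 lt_pq].
- by rewrite size_polyC c0.
- have := p0; have := q0; rewrite size_mul // -!size_poly_gt0.
  by move: (size p) (size q) => a b; lia.
- have sz : (size q < size p)%N
    by move: lt_pq; move: (size p) (size q) => a b; lia.
  by rewrite -size_poly_gt0 size_polyDl // size_poly_gt0.
Qed.

Lemma order_weight (F : fieldType) :
  is_weight (fun p : {poly F} => (mup 0 p)%:Z).
Proof.
split=> [c c0|p q p0 q0|p q p0 q0 lt_pq].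
- by rewrite mupNroot // rootC.
- by rewrite mupM // PoszD.
have Ddvd : ('X - 0%:P : {poly F}) ^+ (mup 0 p).+1 %| q.
  by rewrite -mup_geq //; lia.
have Ndvd : ~~ (('X - 0%:P : {poly F}) ^+ (mup 0 p).+1 %| p + q).
  by rewrite (dvdp_addl _ Ddvd) -mup_geq // ltnn.
have pq0 : p + q != 0 by apply: contraNneq Ndvd => ->; rewrite dvdp0.
split=> //; congr Posz; apply/eqP; rewrite eqn_leq mup_leq // Ndvd /=.
rewrite mup_geq // dvdp_add // -mup_geq //; lia.
Qed.

Lemma cross_multiply (F : fieldType) (a b c d : F) :
  b != 0 -> d != 0 -> a / b = c / d -> a * d = c * b.
Proof. by move=> b0 d0 /eqP; rewrite eqr_div // => /eqP. Qed.

Section Valuation.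
Variables (F : fieldType) (w : {poly F} -> int).
Hypothesis wP : is_weight w.
Local Notation K := {fraction {poly F}}.
Local Notation "p %:F" := (@FracField.tofrac {poly F} p).
Implicit Types (x y : K) (m n : int) (p q : {poly F}).

Lemma val_poly p : p != 0 -> has_val w p%:F (w p).
Proof.
case: wP => wC _ _ p0; exists p, 1; rewrite p0 oner_neq0 rmorph1 divr1.
by split=> //; rewrite (wC 1 (oner_neq0 _)) subr0.
Qed.

Lemma val_const c : c != 0 -> has_val w c%:P%:F 0.
Proof. by case: wP => wC _ _ c0; rewrite -(wC c c0); apply: val_poly; rewrite polyC_eq0. Qed.

Lemma val1 : has_val w 1 0.
Proof. by rewrite -(rmorph1 (@FracField.tofrac {poly F})) -[1]/(1%:P); apply/val_const/oner_neq0. Qed.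

Lemma val_neq0 x n : has_val w x n -> x != 0.
Proof. by case=> p [q [p0 q0 -> _]]; rewrite mulf_neq0 ?invr_eq0 ?tofrac_eq0. Qed.

Lemma val_uniq x m n : has_val w x m -> has_val w x n -> m = n.
Proof.
case: wP => _ wM _; case=> p [q [p0 q0 -> ->]] [p' [q' [p'0 q'0 + ->]]].
have qF : q%:F != 0 by rewrite tofrac_eq0.
have q'F : q'%:F != 0 by rewrite tofrac_eq0.
move=> /(cross_multiply qF q'F) /eqP; rewrite -!tofracM tofrac_eq.
move=> /eqP /(congr1 w); rewrite !wM //.
by move: (w p) (w q) (w p') (w q') => a b c d; lia.
Qed.

Lemma val_mul x y m n : has_val w x m -> has_val w y n -> has_val w (x * y) (m + n).
Proof.
case: wP => _ wM _; case=> p [q [p0 q0 -> ->]] [p' [q' [p'0 q'0 -> ->]]].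
exists (p * p'), (q * q'); rewrite !mulf_neq0 // !wM // !tofracM mulf_div.
by split=> //; rewrite opprD addrACA.
Qed.

Lemma val_inv x n : has_val w x n -> has_val w x^-1 (- n).
Proof. by case=> p [q [p0 q0 -> ->]]; exists q, p; rewrite invf_div opprB. Qed.

Lemma val_add x y m n : has_val w x m -> has_val w y n -> m < n -> has_val w (x + y) m.
Proof.
case: wP => _ wM wD; case=> p [q [p0 q0 -> ->]] [p' [q' [p'0 q'0 -> ->]]] lt_mn.
have lt_w : w (p * q') < w (p' * q).
  by rewrite !wM //; move: lt_mn; move: (w p) (w q) (w p') (w q') => a b c d; lia.
have [s0 ws] := wD _ _ (mulf_neq0 p0 q'0) (mulf_neq0 p'0 q0) lt_w.
exists (p * q' + p' * q), (q * q'); rewrite s0 !mulf_neq0 // ws !wM //.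
rewrite addf_div ?tofrac_eq0 // -!tofracM -tofracD.
by split=> //; rewrite opprD addrACA subrr addr0.
Qed.

Lemma val_expn x n k : has_val w x n -> has_val w (x ^+ k) (k%:Z * n).
Proof.
move=> vx; elim: k => [|k IHk]; first by rewrite mul0r; apply: val1.
have -> : k.+1%:Z * n = n + k%:Z * n by lia.
by rewrite exprS; apply: val_mul.
Qed.

Lemma val_expz x n (k : int) : has_val w x n -> has_val w (x ^ k) (k * n).
Proof.
case: k => k vx; first exact: val_expn.
have -> : Negz k * n = - (k.+1%:Z * n) by lia.
exact/val_inv/val_expn.
Qed.

Local Notation "P @@ x" := ((map_poly (@FracField.tofrac {poly F} \o polyC) P).[x])
  (at level 10).

Lemma map_polyMXaddC_horner p c x :
  (p * 'X + c%:P) @@ x = p @@ x * x + c%:P%:F.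
Proof. by rewrite rmorphD rmorphM /= map_polyX map_polyC hornerMXaddC. Qed.

(** At a pole the leading term dominates: each Horner step adds a constant, of value 0, to a term of
    negative value. *)
Lemma val_horner_neg x n P :
  has_val w x n -> n < 0 -> P != 0 -> has_val w (P @@ x) ((size P).-1%:Z * n).
Proof.
move=> vx n0; elim/poly_ind: P => [|P c IHP]; first by rewrite eqxx.
have [->|P0 _] := eqVneq P 0.
  rewrite mul0r add0r polyC_eq0 => c0; rewrite size_polyC c0 mul0r.
  by rewrite map_polyC hornerC; apply: val_const.
have sz := size_MXaddC P c; rewrite (negPf P0) /= in sz; rewrite sz /=.
have szP : (0 < size P)%N by rewrite size_poly_gt0.
have vPx : has_val w (P @@ x * x) ((size P)%:Z * n).
  have -> : (size P)%:Z * n = (size P).-1%:Z * n + n by nia.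
  exact/val_mul/vx/IHP.
rewrite map_polyMXaddC_horner; have [->|c0] := eqVneq c 0.
  by rewrite !rmorph0 addr0.
by apply: val_add vPx (val_const c0) _; nia.
Qed.

(** At a zero the lowest nonzero term dominates; [k] is its index. *)
Lemma val_horner_pos x n P : has_val w x n -> 0 < n -> P != 0 ->
  exists2 k : nat, has_val w (P @@ x) (k%:Z * n) & P`_0 != 0 -> k = 0%N.
Proof.
move=> vx n0; elim/poly_ind: P => [|P c IHP]; first by rewrite eqxx.
rewrite map_polyMXaddC_horner coefD coefMX coefC add0r /=.
have [->|P0] := eqVneq P 0.
  rewrite mul0r add0r polyC_eq0 => c0; exists 0%N => //.
  by rewrite map_poly0 horner0 mul0r add0r mul0r; apply: val_const.
have [k vP _] := IHP P0.
have vPx : has_val w (P @@ x * x) (k.+1%:Z * n).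
  have -> : k.+1%:Z * n = k%:Z * n + n by lia.
  exact: val_mul.
have [->|c0] := eqVneq c 0 => _.
  by exists k.+1; rewrite ?rmorph0 ?addr0.
exists 0%N => //; rewrite mul0r addrC.
by apply: val_add (val_const c0) vPx _; nia.
Qed.

Lemma val_horner_multiple x n P : has_val w x n -> n != 0 -> P != 0 ->
  exists k : int, has_val w (P @@ x) (k * n).
Proof.
move=> vx n0 P0; have [n_gt0|n_le0] := ltP 0 n.
  by have [k vP _] := val_horner_pos vx n_gt0 P0; exists k.
by exists (size P).-1; apply: val_horner_neg => //; lia.
Qed.

End Valuation.

(** * The ring R_f *)

(** Factors [g] are cancelled while they divide [p]; afterwards [p] and [g] are coprime, and Gauss'
    lemma removes [g] from the other side. *)
Lemma dvdp_irreducible_expM (F : fieldType) (g h p : {poly F}) (n : nat) :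
  irreducible_poly g -> p %| g ^+ n * h ->
  exists k p1, p = g ^+ k * p1 /\ p1 %| h.
Proof.
move=> irr_g; elim: n p => [|n IHn] p.
  by rewrite mul1r; exists 0%N, p; rewrite mul1r.
have [g_p|Ng_p] := boolP (g %| p); rewrite exprS -mulrA => p_dv.
  move: p_dv; case/dvdpP: g_p => p' ->; rewrite [p' * g]mulrC.
  rewrite dvdp_mul2l ?irredp_neq0 // => /IHn[k [p1 [-> p1_h]]].
  by exists k.+1, p1; rewrite exprS mulrA.
move: p_dv; rewrite Gauss_dvdpr; first exact: IHn.
by rewrite coprimep_sym irreducible_poly_coprime.
Qed.

Lemma F2_neq0 (c : 'F_2) : c != 0 -> c = 1.
Proof. by case: c => [[|[|?]] ?] //= _; apply: val_inj. Qed.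

Lemma F2_cases (c : 'F_2) : c = 0 \/ c = 1.
Proof. by have [->|/F2_neq0 ->] := eqVneq c 0; [left|right]. Qed.

Lemma F2_lead_coef (p : P2) : p != 0 -> lead_coef p = 1.
Proof. by rewrite -lead_coef_eq0; apply: F2_neq0. Qed.

Lemma F2_eqp (p q : P2) : p %= q -> p = q.
Proof.
case/eqpf_eq=> c c0 ->; by rewrite (F2_neq0 c0) scale1r.
Qed.

Lemma irreducible_polyX (F : fieldType) : irreducible_poly ('X : {poly F}).
Proof. by have := irredp_XsubC (0 : F); rewrite subr0. Qed.

Local Notation t2 := (frac2 'X).
Local Notation horner2 P x := ((map_poly (fun c : 'F_2 => frac2 c%:P) P).[x]).

Lemma frac2M p q : frac2 (p * q) = frac2 p * frac2 q.
Proof. exact: tofracM. Qed.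

Lemma frac2D p q : frac2 (p + q) = frac2 p + frac2 q.
Proof. exact: tofracD. Qed.

Lemma frac2X p n : frac2 (p ^+ n) = frac2 p ^+ n.
Proof. exact: tofracXn. Qed.

Lemma frac21 : frac2 1 = 1.
Proof. exact: tofrac1. Qed.

Lemma frac2_eq0 p : (frac2 p == 0) = (p == 0).
Proof. exact: tofrac_eq0. Qed.

Lemma frac2_inj : injective frac2.
Proof. by move=> p q /eqP; rewrite tofrac_eq => /eqP. Qed.

Lemma t2_neq0 : t2 != 0.
Proof. by rewrite frac2_eq0 polyX_eq0. Qed.

Lemma monomial_div (F : fieldType) (x y : F) (a b c d : nat) :
  x != 0 -> y != 0 ->
  (x ^+ a * y ^+ b) / (x ^+ c * y ^+ d) =
    x ^ (a%:Z - c%:Z) * y ^ (b%:Z - d%:Z).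
Proof.
by move=> x0 y0; rewrite !expfzDr // -!exprz_inv -!exprnP !exprVn invfM mulrACA.
Qed.

Section RingRf.
Variable f : P2.
Hypothesis irr_f : irreducible_poly f.

Lemma den_neq0 a b : frac2 ('X ^+ a * f ^+ b) != 0.
Proof. by rewrite frac2_eq0 mulf_neq0 // expf_neq0 ?polyX_eq0 ?irredp_neq0. Qed.

Lemma inRf_frac2 p : inRf f (frac2 p).
Proof. by exists p, 0%N, 0%N; rewrite !expr0 mul1r frac21 divr1. Qed.

Lemma inRf0 : inRf f 0.
Proof. by rewrite -[0]/(frac2 0); apply: inRf_frac2. Qed.

Lemma inRf1 : inRf f 1.
Proof. by rewrite -frac21; apply: inRf_frac2. Qed.

Lemma inRfD x y : inRf f x -> inRf f y -> inRf f (x + y).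
Proof.
case=> [p [a [b ->]]] [q [c [d ->]]].
exists (p * ('X ^+ c * f ^+ d) + q * ('X ^+ a * f ^+ b)), (a + c)%N, (b + d)%N.
by rewrite addf_div ?den_neq0 // -!frac2M -frac2D !exprD [X in _ / frac2 X]mulrACA.
Qed.

Lemma inRfM x y : inRf f x -> inRf f y -> inRf f (x * y).
Proof.
case=> [p [a [b ->]]] [q [c [d ->]]]; exists (p * q), (a + c)%N, (b + d)%N.
by rewrite mulf_div -!frac2M !exprD [X in _ / frac2 X = _]mulrACA.
Qed.

Lemma inRf_den a b : inRf f (frac2 ('X ^+ a * f ^+ b))^-1.
Proof. by exists 1, a, b; rewrite frac21 mul1r. Qed.

Lemma unitRf_inv x : unitRf f x -> unitRf f x^-1.
Proof.
case=> Rx [y [Ry xy]]; suff -> : x^-1 = y by split=> //; exists x; rewrite mulrC.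
have x0 : x != 0 by apply: contraTneq isT => x0; move/eqP: xy; rewrite x0 mul0r eq_sym oner_eq0.
by rewrite -[LHS]mulr1 -xy mulKf.
Qed.

Lemma unitRfM x y : unitRf f x -> unitRf f y -> unitRf f (x * y).
Proof.
case=> Rx [x' [Rx' xx']] [Ry [y' [Ry' yy']]].
split; [exact: inRfM | exists (x' * y'); split; first exact: inRfM].
by rewrite mulrACA xx' yy' mulr1.
Qed.

Lemma unitRf1 : unitRf f 1.
Proof. by split; [exact: inRf1|exists 1; rewrite mulr1; split=> //; exact: inRf1]. Qed.

Lemma unitRfX x n : unitRf f x -> unitRf f (x ^+ n).
Proof.
move=> ux; elim: n => [|n IHn]; first exact: unitRf1.
by rewrite exprS; apply: unitRfM.
Qed.

Lemma unitRf_neq0 x : unitRf f x -> x != 0.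
Proof.
by case=> _ [y [_ xy]]; apply/eqP=> x0; move/eqP: xy; rewrite x0 mul0r eq_sym oner_eq0.
Qed.

Lemma unitRf_t : unitRf f t2.
Proof.
split; first exact: inRf_frac2.
exists t2^-1; split; last by rewrite mulfV // t2_neq0.
by have := inRf_den 1 0; rewrite expr1 expr0 mulr1.
Qed.

Lemma unitRf_f : unitRf f (frac2 f).
Proof.
split; first exact: inRf_frac2.
exists (frac2 f)^-1; split; last by rewrite mulfV // frac2_eq0 irredp_neq0.
by have := inRf_den 0 1; rewrite expr1 expr0 mul1r.
Qed.

(** The numerator of a unit divides a product of powers of the irreducibles ['X] and [f]; stripping
    both leaves a constant, which over ['F_2] is 1. *)
Lemma unitRfE x : unitRf f x -> exists i j : int, x = t2 ^ i * frac2 f ^ j.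
Proof.
have t0 := t2_neq0.
have f0 : frac2 f != 0 by rewrite frac2_eq0 irredp_neq0.
case=> [[p [a [b xE]]]] [y [[q [c [d yE]]] xy1]].
have : p %| 'X ^+ (a + c) * (f ^+ (b + d) * 1).
  suff -> : 'X ^+ (a + c) * (f ^+ (b + d) * 1) = p * q by exact: dvdp_mulr.
  apply: frac2_inj; move: xy1; rewrite xE yE mulf_div => /(canRL (divfK _)).
  rewrite -!frac2M => ->; first by rewrite mul1r mulr1 !exprD mulrACA.
  by rewrite frac2M mulf_neq0 ?den_neq0.
case/(dvdp_irreducible_expM (@irreducible_polyX _)) => k [p1 [pE]].
case/(dvdp_irreducible_expM irr_f) => l [p2 [p1E]].
rewrite dvdp1 => /eqP sz.
have p21 : p2 = 1 by apply: F2_eqp; rewrite -size_poly_eq1 sz.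
have {}pE : p = 'X ^+ k * f ^+ l by rewrite pE p1E p21 mulr1.
exists (k%:Z - a%:Z), (l%:Z - b%:Z).
rewrite xE pE (frac2M ('X ^+ k)) (frac2M ('X ^+ a)) !frac2X.
exact: (monomial_div k l a b t0 f0).
Qed.

End RingRf.

Lemma horner2E P x :
  horner2 P x = (map_poly (@FracField.tofrac P2 \o polyC) P).[x].
Proof. by []. Qed.

Lemma horner2C c x : horner2 c%:P x = frac2 c%:P.
Proof. by rewrite horner2E map_polyC hornerC. Qed.

Lemma horner2_MXaddC P c x :
  horner2 (P * 'X + c%:P) x = horner2 P x * x + frac2 c%:P.
Proof. exact: map_polyMXaddC_horner. Qed.

Lemma horner2_1 P : exists c, horner2 P 1 = frac2 c%:P.
Proof.
elim/poly_ind: P => [|P c [d IHP]].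
  by exists 0; rewrite -[0 in LHS]/(0%:P) horner2C.
by exists (d + c); rewrite horner2_MXaddC IHP mulr1 -frac2D polyCD.
Qed.

Lemma horner2_t P : horner2 P t2 = frac2 P.
Proof.
elim/poly_ind: P => [|P c IHP].
  by rewrite -[0 in LHS]/(0%:P) horner2C.
by rewrite horner2_MXaddC IHP frac2D frac2M.
Qed.

(** * Rigidity of the units that generate the field of rational functions *)

Section ShortPalindromes.
Variables (K : fieldType) (t : K).
Hypothesis t0 : t != 0.

Lemma palindrome2 : t ^+ 1 * (1 * t^-1 + 1) = t + 1.
Proof. by rewrite expr1 mul1r mulrDr mulfV // mulr1 addrC. Qed.

Lemma palindrome3 c : t ^+ 2 * ((1 * t^-1 + c) * t^-1 + 1) = (1 * t + c) * t + 1.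
Proof. by field. Qed.

End ShortPalindromes.

Lemma normz_dvd1 (n m : int) : `|n * m| = 1 -> `|n| = 1.
Proof.
rewrite normrM; have := normr_ge0 n; have := normr_ge0 m.
move: (`|n| : int) (`|m| : int) => x y y0 x0 xy.
have y1 : y <> 0 by move=> yE; rewrite yE mulr0 in xy.
nia.
Qed.

Section Rigidity.
Variable f : P2.
Hypothesis irr_f : irreducible_poly f.
Hypothesis f_neqX : f != 'X.
Hypothesis nsr_f : ~ self_reciprocal f.

Lemma coef0_neq0 : f`_0 != 0.
Proof.
apply: contra f_neqX => f0; apply/eqP/esym/F2_eqp.
apply: irr_f; first by rewrite size_polyX.
by rewrite -['X]subr0 dvdp_XsubCl rootE horner_coef0.
Qed.

(** Leading and constant coefficients are 1, so in degree 1 or 2 [f] would be [t + 1] or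
    [t^2 + c t + 1], both palindromes. *)
Lemma size_not_self_reciprocal : (3 < size f)%N.
Proof.
have fn := irredp_neq0 irr_f.
have lc := F2_lead_coef fn; have c0 := F2_neq0 coef0_neq0.
have : (1 < size f)%N by case: irr_f.
move: lc; rewrite /lead_coef leq_eqVlt => lc /orP[/eqP sz|].
  case: nsr_f; rewrite /self_reciprocal.
  have fE : f = 1%:P * 'X + 1%:P.
    apply/polyP=> [[|[|i]]]; rewrite coefD coefMX !coefC /= ?add0r ?addr0 //.
      by rewrite -lc -sz.
    by rewrite nth_default // -sz.
  rewrite -sz fE horner2_MXaddC horner2C frac2X.
  rewrite frac2D frac2M (frac21 : frac2 1%:P = 1) mul1r.
  exact: (palindrome2 t2_neq0).
rewrite leq_eqVlt => /orP[/eqP sz|//].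
case: nsr_f; rewrite /self_reciprocal.
have fE : f = (1%:P * 'X + (f`_1)%:P) * 'X + 1%:P.
  apply/polyP=> [[|[|[|i]]]].
  - by rewrite coefD coefMX coefC add0r.
  - by rewrite !(coefD, coefMX, coefC) /= add0r addr0.
  - by rewrite !(coefD, coefMX, coefC) /= !addr0 -lc -sz.
  - by rewrite !(coefD, coefMX, coefC) /= !addr0 nth_default // -sz.
rewrite -sz fE !horner2_MXaddC horner2C frac2X.
rewrite !(frac2D, frac2M) (frac21 : frac2 1%:P = 1). exact: (palindrome3 t2_neq0).
Qed.

Let w0 (p : P2) : int := (mup 0 p)%:Z.
Let winf (p : P2) : int := 1 - (size p)%:Z.
Let w0P : is_weight w0 := order_weight _.
Let winfP : is_weight winf := degree_weight _.

Lemma order_t : has_val w0 t2 1.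
Proof.
have -> : 1 = w0 'X by rewrite /w0; have := mup_XsubCX 1 (0 : 'F_2) 0; rewrite eqxx expr1 subr0 => ->.
by apply: (val_poly w0P); rewrite polyX_eq0.
Qed.

Lemma order_f : has_val w0 (frac2 f) 0.
Proof.
have -> : 0 = w0 f by rewrite /w0 mupNroot // rootE horner_coef0 coef0_neq0.
exact/(val_poly w0P)/irredp_neq0.
Qed.

Lemma degree_t : has_val winf t2 (-1).
Proof.
have -> : -1 = winf 'X by rewrite /winf size_polyX.
by apply: (val_poly winfP); rewrite polyX_eq0.
Qed.

Lemma degree_f : has_val winf (frac2 f) (1 - (size f)%:Z).
Proof. exact/(val_poly winfP)/irredp_neq0. Qed.

Lemma val_monomial w a b i j : is_weight w -> has_val w t2 a -> has_val w (frac2 f) b ->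
  has_val w (t2 ^ i * frac2 f ^ j) (i * a + j * b).
Proof. by move=> wP va vb; apply: val_mul => //; apply: val_expz. Qed.

(* The value group of F_2(tau) is generated by the value of tau when the latter
   is nonzero, and it must contain the value of t. *)
Lemma val_generator w tau n e a b P : is_weight w ->
  has_val w tau n -> n != 0 -> has_val w t2 e ->
  t2 * (tau ^+ a * horner2 f tau ^+ b) = horner2 P tau -> `|e| = 1 -> `|n| = 1.
Proof.
move=> wP vtau n0 vt eqP_ e1.
have [k vf] := val_horner_multiple wP vtau n0 (irredp_neq0 irr_f).
have vL := val_mul wP vt (val_mul wP (val_expn wP a vtau) (val_expn wP b vf)).
have P0 : P != 0.
  apply: contraTneq (val_neq0 vL) => P0; move: eqP_; rewrite P0 !horner2E.
  by rewrite map_poly0 horner0 => ->; rewrite eqxx.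
have [l vR] := val_horner_multiple wP vtau n0 P0.
rewrite -!horner2E eqP_ in vL; have := val_uniq wP vL vR => eq_val.
have : e = n * (l - a%:Z - b%:Z * k) by lia.
by move=> eE; apply: (@normz_dvd1 _ (l - a%:Z - b%:Z * k)); rewrite -eE.
Qed.

(** The equation makes [t] a rational function of [tau], so [val_generator] bounds the values of
    [tau] at 0 and at infinity. *)
Lemma unit_generator tau a b P :
  unitRf f tau -> unitRf f (horner2 f tau) ->
  t2 * (tau ^+ a * horner2 f tau ^+ b) = horner2 P tau -> tau = t2.
Proof.
move=> utau uftau eq_t; have [i [j tauE]] := unitRfE irr_f utau.
have v0 := val_monomial i j w0P order_t order_f.
have vinf := val_monomial i j winfP degree_t degree_f.
rewrite -tauE in v0 vinf.
have sz := size_not_self_reciprocal.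
have i1 : i != 0 -> `|i| = 1.
  by move=> i0; apply: (val_generator w0P _ _ order_t eq_t) => //; move: v0; rewrite mulr1 mulr0 addr0.
have d1 : i * -1 + j * (1 - (size f)%:Z) != 0 -> `|i * -1 + j * (1 - (size f)%:Z)| = 1.
  by move=> d0; apply: (val_generator winfP vinf d0 degree_t eq_t).
(* The value at infinity is [-i - j deg f]; with [|i| <= 1] and [deg f >= 3] its absolute value is
   at most 1 only for [j = 0]. *)
have j0 : j = 0.
  clear -i1 d1 sz; move: (size f) sz d1 i1 => s; nia.
move: tauE; rewrite j0 expr0z mulr1 => tauE.
(* If [i = 0] then [tau = 1], and the equation would make [t] a constant. *)
have [i0|i_n0] := eqVneq i 0.
  move: eq_t uftau; rewrite tauE i0 expr0z expr1n mul1r.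
  have [c ->] := horner2_1 f; have [d ->] := horner2_1 P => eq_t uc.
  have c1 : c = 1.
    by apply: F2_neq0; have := unitRf_neq0 uc; rewrite frac2_eq0 polyC_eq0.
  move: eq_t; rewrite c1 frac21 expr1n mulr1 => /frac2_inj /(congr1 (fun p : P2 => size p)).
  by rewrite size_polyX size_polyC; case: (d == 0).
have [i1'|i1'] : i = 1 \/ i = -1 by move: (i1 i_n0); clear; lia.
  by rewrite tauE i1' expr1z.
(* Now [tau = t^-1], and the unit [f(1/t)] is some [t^k f^l]. It has order [-deg f] at 0, and order
   0 at infinity because [f] has a constant term. Hence [k = -deg f] and [l = 1], which is
   self-reciprocity. *)
case: nsr_f; rewrite /self_reciprocal.
have {}tauE : tau = t2^-1 by rewrite tauE i1' exprN1.
have [k [l fE]] := unitRfE irr_f uftau.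
have u0 := val_horner_neg w0P (val_inv order_t) isT (irredp_neq0 irr_f).
have [x uinf xE] := val_horner_pos winfP (val_inv degree_t) isT (irredp_neq0 irr_f).
rewrite xE ?coef0_neq0 // in uinf.
rewrite -tauE -!horner2E fE in u0 uinf.
have e0 := val_uniq w0P u0 (val_monomial k l w0P order_t order_f).
have einf := val_uniq winfP uinf (val_monomial k l winfP degree_t degree_f).
have kE : k = - (size f).-1%:Z.
  by move: e0; clear; move: (size f) => s; lia.
have l1 : l = 1 by move: einf sz; rewrite kE; clear; move: (size f) => s; nia.
rewrite -tauE fE l1 expr1z kE frac2X exprnP mulrA -expfzDr ?t2_neq0 //.
by rewrite subrr expr0z mul1r.
Qed.

End Rigidity.

(** * The quotient group in coordinates *)

(* The class modulo the centre of the matrix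
   [[1, a, p, *], [0, u, b, q], [0, 0, v, c], [0, 0, 0, 1]]. *)
Record coords (K : Type) := Coords
  { cu : K; cv : K; ca : K; cb : K; cc : K; cp : K; cq : K }.

(** Matrix multiplication without the (1,4)-entry, on which no other entry of a product depends. *)
Definition cmul (K : fieldType) (x y : coords K) : coords K :=
  Coords (cu x * cu y) (cv x * cv y)
    (ca y + ca x * cu y) (cu x * cb y + cb x * cv y) (cv x * cc y + cc x)
    (cp y + ca x * cb y + cp x * cv y) (cu x * cq y + cb x * cc y + cq x).

(** * Automorphisms of the coordinate group over a ring of characteristic 2 *)

Section CoordGroup.
Variables (K : fieldType) (R : K -> Prop).
Hypotheses (R0 : R 0) (R1 : R 1).
Hypothesis RD : forall x y, R x -> R y -> R (x + y).
Hypothesis RM : forall x y, R x -> R y -> R (x * y).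
Hypothesis char2 : forall x : K, x + x = 0.

Local Notation U := (fun x => R x /\ exists y, R y /\ x * y = 1).
Local Notation "x ** y" := (cmul x y) (at level 40, left associativity).
Local Notation nil_mx := (Coords (1 : K) 1).
Local Notation diag u v := (Coords (u : K) v 0 0 0 0 0).
Local Notation E23 r := (nil_mx 0 r 0 0 0).
Local Notation h0 := (nil_mx 1 0 1 0 0).

Definition inG (x : coords K) : Prop :=
  [/\ U (cu x), U (cv x) & [/\ R (ca x), R (cb x), R (cc x), R (cp x) & R (cq x)]].

Definition unip (x : coords K) : Prop := cu x = 1 /\ cv x = 1.

Variable s : K.
Hypotheses (Us : U s) (s_neq1 : s != 1).

Variable psi : coords K -> coords K.
Hypothesis psiG : forall x, inG x -> inG (psi x).
Hypothesis psiM : forall x y, inG x -> inG y -> psi (x ** y) = psi x ** psi y.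
Hypothesis psi_inj : forall x y, inG x -> inG y -> psi x = psi y -> x = y.
Hypothesis psi_surj : forall y, inG y -> exists2 x, inG x & psi x = y.

Lemma char2_opp (x : K) : - x = x.
Proof. by apply/eqP; rewrite eq_sym -addr_eq0 char2. Qed.

Lemma char2_sqr1 (x : K) : x * x = 1 -> x = 1.
Proof.
move=> xx; apply/eqP; rewrite -subr_eq0 -[_ == _]orbb -mulf_eq0.
have -> : (x - 1) * (x - 1) = (x * x + 1) - (x + x) by ring.
by rewrite xx !char2 subrr.
Qed.

Lemma U1 : U (1 : K).
Proof. by split=> //; exists 1; rewrite mulr1. Qed.

Lemma U_neq0 x : U x -> x != 0.
Proof. by case=> _ [y [_ xy]]; apply: contra_eq_neq xy => ->; rewrite mul0r eq_sym oner_eq0. Qed.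

Lemma U_inv x : U x -> R x^-1.
Proof.
move=> Ux; have x0 := U_neq0 Ux; case: Ux => _ [y [Ry xy]].
by rewrite -[_^-1]mulr1 -xy mulKf.
Qed.

Lemma UM x y : U x -> U y -> U (x * y).
Proof.
case=> Rx [x' [Rx' xx']] [Ry [y' [Ry' yy']]].
by split; [exact: RM|exists (x' * y'); split; [exact: RM|rewrite mulrACA xx' yy' mulr1]].
Qed.

Lemma cmulG x y : inG x -> inG y -> inG (x ** y).
Proof.
case=> [[Rux xu] [Rvx xv] [x1 x2 x3 x4 x5]] [[Ruy yu] [Rvy yv] [y1 y2 y3 y4 y5]].
split=> /=; first exact: UM; first exact: UM.
by split; do ?[apply: RD | apply: RM].
Qed.

Lemma inG_nil a b c p q : R a -> R b -> R c -> R p -> R q -> inG (nil_mx a b c p q).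
Proof. by split; [exact: U1|exact: U1|split]. Qed.

Lemma inG_diag u v : U u -> U v -> inG (diag u v).
Proof. by split. Qed.

Local Ltac inG_tac := do ?[assumption | exact: U1 | apply: cmulG | apply: inG_nil | apply: inG_diag].

Lemma inG_E23 r : R r -> inG (E23 r).
Proof. by move=> Rr; inG_tac. Qed.

Lemma inG_h0 : inG h0.
Proof. by inG_tac. Qed.

Lemma coords_eq (x y : coords K) :
  [/\ cu x = cu y, cv x = cv y & [/\ ca x = ca y, cb x = cb y, cc x = cc y,
      cp x = cp y & cq x = cq y]] -> x = y.
Proof.
by case: x y => [? ? ? ? ? ? ?] [? ? ? ? ? ? ?] /= [-> -> [-> -> -> -> ->]].
Qed.

(* The order divides 4, stated as x^5 = x so that psi preserves it without
   computing psi of the identity. *)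
Lemma unipP x : inG x -> (unip x <-> x ** x ** (x ** x) ** x = x).
Proof.
case=> Uu Uv _; split=> [[u1 v1]|E].
  (* The square keeps only the (1,3) and (2,4) coordinates, which add up under multiplication and so
     vanish on squaring again. *)
  have xx : x ** x = nil_mx 0 0 0 (ca x * cb x) (cb x * cc x).
    apply: coords_eq; split=> /=; rewrite ?u1 ?v1 ?mulr1 ?mul1r //; split=> //.
    - by rewrite addrAC char2 add0r.
    - by rewrite [_ + cq x]addrC addrA char2 add0r.
  have xxxx : x ** x ** (x ** x) = nil_mx 0 0 0 0 0.
    rewrite xx; apply: coords_eq.
    by split=> /=; rewrite ?mulr1 //; split; rewrite ?(mul0r, mulr0, mulr1, mul1r, addr0, char2).
  rewrite xxxx; apply: coords_eq; split=> /=; rewrite ?mul1r //.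
  by split; rewrite ?(mul0r, mulr0, mulr1, mul1r, addr0, add0r).
have root4 w : U w -> w * w * (w * w) * w = w -> w = 1.
  move=> Uw /eqP; rewrite -[X in _ == X]mul1r; move/eqP/(mulIf (U_neq0 Uw)).
  by move=> /char2_sqr1 /char2_sqr1.
by split; apply: root4 => //; [move/(congr1 (@cu K)): E|move/(congr1 (@cv K)): E].
Qed.

Lemma psi_unip x : inG x -> (unip x <-> unip (psi x)).
Proof.
move=> Gx; rewrite (unipP Gx) (unipP (psiG Gx)).
rewrite -!psiM; do ?[exact: cmulG|apply: cmulG]; rewrite //; do ?exact: cmulG.
split=> [-> //|]; apply: psi_inj => //; do ?[exact: Gx|apply: cmulG].
Qed.

(** Commutation and conjugation are written in this form so that they pass through [psi] both ways
    without inverses. *)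
Lemma psi_rel x y z t : inG x -> inG y -> inG z -> inG t ->
  psi x ** psi y = psi z ** psi t <-> x ** y = z ** t.
Proof.
move=> Gx Gy Gz Gt; rewrite -!psiM //; split=> [|-> //].
by apply: psi_inj; apply: cmulG.
Qed.

Lemma unip_commute x y : unip x -> unip y ->
  x ** y = y ** x <-> ca x * cb y = ca y * cb x /\ cb x * cc y = cb y * cc x.
Proof.
case=> ux vx [uy vy]; split=> [E|[Ep Eq]].
  move/(congr1 (@cp K)): (E) => /=; move/(congr1 (@cq K)): (E) => /=.
  rewrite ux uy vx vy !mul1r !mulr1 => Eq Ep; split.
    apply: (addrI (cp x + cp y)); move: Ep; set l := _ * _; set r := _ * _.
    by move=> Ep; transitivity (cp y + l + cp x); [ring|rewrite Ep; ring].
  apply: (addrI (cq x + cq y)); move: Eq; set l := _ * _; set r := _ * _.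
  by move=> Eq; transitivity (cq y + l + cq x); [ring|rewrite Eq; ring].
apply: coords_eq; rewrite /= ux uy vx vy !mul1r !mulr1 Ep Eq.
by split=> //; split; ring.
Qed.

Lemma psi_h0_unip : unip (psi h0).
Proof. by apply/(psi_unip inG_h0). Qed.

Lemma s_sqr_neq1 : s * s - 1 != 0.
Proof. by rewrite subr_eq0; apply: contra s_neq1 => /eqP/char2_sqr1 ->. Qed.

(* h0 commutes with all its conjugates; comparing with conjugation by
   diag(s, 1) leaves only elements with b = 0 or with a = c = 0. *)
Lemma psi_h0_mul0 : ca (psi h0) * cb (psi h0) = 0 /\ cb (psi h0) * cc (psi h0) = 0.
Proof.
have Gh := inG_h0; have Gk := psiG Gh; have [ku kv] := psi_h0_unip.
have s0 := U_neq0 Us; set k := psi h0 in Gk ku kv *.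
have [_ _ [ka kb kc kp kq]] := Gk.
have Rs : R s by case: Us.
(* The conjugate of [k] by [diag s 1]; its preimage [h'] is a conjugate of [h0]. *)
pose k' := nil_mx (ca k / s) (s * cb k) (cc k) (cp k) (s * cq k).
have Gk' : inG k'.
  by apply: inG_nil => //; apply: RM => //; apply: U_inv.
have GX : inG (diag s 1) by inG_tac.
have [Y GY YE] := psi_surj GX; have [h' Gh' hE] := psi_surj Gk'.
have conj_k : diag s 1 ** k = k' ** diag s 1.
  apply: coords_eq; split=> /=; rewrite ?ku ?kv //; first by rewrite mulrC.
  by split; rewrite ?(mul0r, mulr0, mulr1, mul1r, addr0, add0r, divfK).
have conj_h : Y ** h0 = h' ** Y by apply/psi_rel => //; rewrite YE hE.
have h'u : unip h' by apply/psi_unip; rewrite ?hE.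
have b0 : cb h' = 0.
  move/(congr1 (@cb K)): conj_h => /=; case: h'u => -> _.
  rewrite mulr0 mulr1 add0r mul1r => /eqP; rewrite -subr_eq0 opprD addrA subrr.
  rewrite sub0r oppr_eq0 mulf_eq0 => /orP[/eqP //|]; case: GY => _ /U_neq0 /negPf -> //.
have : h0 ** h' = h' ** h0.
  by apply/unip_commute => //; rewrite /= b0 !mulr0 !mul0r.
move/(psi_rel Gh Gh' Gh' Gh); rewrite hE -/k => /unip_commute[] //= Ep Eq.
(* Commutation of [k] and [k'] reads [a s b = (a / s) b] and [b c = s b c], and neither [s^2] nor
   [s] is 1. *)
split; apply/eqP.
  rewrite -[_ == 0]orbF -(negPf s_sqr_neq1) -mulf_eq0 mulrBr mulr1 subr_eq0.
  apply/eqP; transitivity (ca k * (s * cb k) * s); first by ring.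
  by rewrite Ep mulrAC divfK.
suff : cb k * cc k * (s - 1) == 0 by rewrite mulf_eq0 subr_eq0 (negPf s_neq1) orbF.
by rewrite mulrBr mulr1 subr_eq0; apply/eqP; rewrite [RHS]Eq; ring.
Qed.

(* If a = c = 0, then diag(s, s) fixes psi h0 modulo the centre of the
   unipotent part, whereas only unipotent elements fix h0 in this sense. *)
Lemma psi_h0_b : cb (psi h0) = 0.
Proof.
apply/eqP; apply/negPn/negP => b_neq0.
have [/eqP + /eqP] := psi_h0_mul0.
rewrite !mulf_eq0 (negPf b_neq0) orbF /= => /eqP a0 /eqP c0.
have Gh := inG_h0; have Gk := psiG Gh; have [ku kv] := psi_h0_unip.
have s0 := U_neq0 Us; set k := psi h0 in Gk ku kv a0 c0 *.
have [_ _ [_ _ _ kp kq]] := Gk; have Rs : R s by case: Us.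
(* With [a = c = 0], conjugation by [diag s s] changes only the last two coordinates of [k]; [z] is
   that correction, central among unipotent elements. *)
pose z := nil_mx 0 0 0 (cp k / s - cp k) (s * cq k - cq k).
have Gz : inG z.
  by apply: inG_nil => //; rewrite char2_opp; apply: RD => //; apply: RM => //; apply: U_inv.
have GX : inG (diag s s) by inG_tac.
have [Y GY YE] := psi_surj GX; have [z0 Gz0 zE] := psi_surj Gz.
have conj_k : diag s s ** k = (z ** k) ** diag s s.
  apply: coords_eq; split=> /=; rewrite ?ku ?kv ?mul1r ?mulr1 //.
  split; rewrite ?a0 ?c0; try by field.
have conj_h : Y ** h0 = (z0 ** h0) ** Y.
  apply/psi_rel => //; first exact: cmulG.
  by rewrite YE psiM // zE.
have z0u : unip z0 by apply/psi_unip; rewrite ?zE.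
have z0C n : inG n -> unip n -> z0 ** n = n ** z0.
  move=> Gn /(psi_unip Gn) nu; apply/psi_rel => //; rewrite zE.
  by apply/unip_commute => //=; rewrite !mul0r !mulr0.
have uni a b c p q : unip (nil_mx a b c p q) by [].
(* Commuting with [1 + e_12] and [1 + e_23] forces the [a], [b], [c] coordinates of [z0] to
   vanish. *)
have G12 : inG (nil_mx 1 0 0 0 0) by inG_tac.
have [Eb _] := (unip_commute z0u (uni _ _ _ _ _)).1 (z0C _ G12 (uni _ _ _ _ _)).
have [Ea Ec] := (unip_commute z0u (uni _ _ _ _ _)).1 (z0C _ (inG_E23 R1) (uni _ _ _ _ _)).
rewrite /= mulr0 mul1r in Eb; rewrite /= mulr1 mul0r in Ea.
rewrite /= mulr0 mul1r in Ec.
(* The (1,2) and (3,4) coordinates of [conj_h] give [cu Y = 1] and [cv Y = 1]. *)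
have Yu : unip Y.
  case: z0u => zu zv; split.
    move/(congr1 (@ca K)): conj_h => /=.
    by rewrite -?Eb ?Ea !(mulr1, mul0r, mul1r, addr0) addrC => /addrI.
  move/(congr1 (@cc K)): conj_h => /=; rewrite zv -?Ec !(mulr1, mul1r, addr0).
  by rewrite addrC => /addrI.
by have [/= sE _] := (psi_unip GY).1 Yu; move: s_neq1; rewrite YE /= in sE; rewrite sE eqxx.
Qed.

Lemma h0_E23 : h0 ** E23 1 <> E23 1 ** h0.
Proof. by move=> /unip_commute[] //= /eqP; rewrite !mulr1 mul0r oner_eq0. Qed.

(** Such [x] commutes with [h0]. If [psi x] had nonzero [b], then [psi h0] would have
    [a = b = c = 0] and commute with every unipotent element, although [h0] does not commute with
    [E23 1]. *)
Lemma psi_b0 x : inG x -> unip x -> cb x = 0 -> cb (psi x) = 0.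
Proof.
move=> Gx ux bx; have Gh := inG_h0; have ku := psi_h0_unip; have kb := psi_h0_b.
have pu := (psi_unip Gx).1 ux.
have : h0 ** x = x ** h0 by apply/unip_commute => //=; rewrite bx !mulr0 !mul0r.
move/(psi_rel Gh Gx Gx Gh)/(unip_commute ku pu); rewrite kb mulr0 mul0r.
case=> /eqP + /esym/eqP; rewrite !mulf_eq0.
have [//|_] := eqVneq (cb (psi x)) 0; rewrite orbF /= => /eqP ka /eqP kc.
case: h0_E23; have GE := inG_E23 R1; apply/(psi_rel Gh GE GE Gh).
apply/(unip_commute ku ((psi_unip GE).1 (conj erefl erefl))).
by rewrite ka kb kc !mul0r !mulr0.
Qed.

(** The map induced by [psi] on unipotent elements modulo those with [b = 0], a quotient identified
    with [R]. *)
Definition bmap (r : K) : K := cb (psi (E23 r)).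

Lemma bmapR r : R r -> R (bmap r).
Proof. by move=> /inG_E23/psiG[_ _ []]. Qed.

Lemma psi_E23_unip r : R r -> unip (psi (E23 r)).
Proof. by move=> Rr; apply/(psi_unip (inG_E23 Rr)). Qed.

Lemma bmap1_neq0 : bmap 1 != 0.
Proof.
apply/eqP=> b0; case: h0_E23; have Gh := inG_h0; have GE := inG_E23 R1.
apply/(psi_rel Gh GE GE Gh)/(unip_commute psi_h0_unip (psi_E23_unip R1)).
by rewrite psi_h0_b -/(bmap 1) b0 !mulr0 !mul0r.
Qed.

Lemma bmapD r r' : R r -> R r' -> bmap (r + r') = bmap r + bmap r'.
Proof.
move=> Rr Rr'; have -> : bmap (r + r') = cb (psi (E23 r ** E23 r')).
  congr (cb (psi _)); apply: coords_eq => /=.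
  by split; [ring|ring|split; ring].
rewrite psiM; [|exact: inG_E23|exact: inG_E23] => /=.
by have [-> _] := psi_E23_unip Rr; have [_ ->] := psi_E23_unip Rr'; rewrite mul1r mulr1 addrC.
Qed.

Lemma bmap_surj r : R r -> exists2 r', R r' & bmap r' = r.
Proof.
move=> Rr; have [g Gg gE] := psi_surj (inG_E23 Rr).
have gu : unip g by apply/psi_unip; rewrite ?gE.
have [_ _ [Ra Rb Rc Rp Rq]] := Gg; exists (cb g) => //.
(* The factor of [g] left after splitting off [E23 (cb g)]; by [psi_b0] it does not affect the (2,3)
   coordinate of the image. *)
pose y := nil_mx (ca g) 0 (cc g) (cp g) (cq g - cb g * cc g).
have Gy : inG y by inG_tac; rewrite char2_opp; apply: RD => //; apply: RM.
have gE' : g = E23 (cb g) ** y.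
  have [gu1 gv1] := gu; apply: coords_eq => /=; rewrite gu1 gv1.
  by split; [ring|ring|split; ring].
have := gE; rewrite {1}gE' psiM //; last exact: inG_E23.
move/(congr1 (@cb K)) => /=; have [_ yv] := (psi_unip Gy).1 (conj erefl erefl).
by rewrite psi_b0 // yv mulr0 add0r mulr1.
Qed.

(** The diagonal part of [x] conjugates [E23 r] to [E23 (w * r)], and the unipotent part does not
    affect the diagonal of [psi x]. Both ratios are cross-multiplied. *)
Lemma bmap_equivariant x w r : inG x -> R w -> R r -> cu x = w * cv x ->
  cu (psi x) * bmap r = bmap (w * r) * cv (psi x).
Proof.
move=> Gx Rw Rr wE; have [Uu Uv [Ra Rb Rc Rp Rq]] := Gx.
have u0 := U_neq0 Uu; have v0 := U_neq0 Uv.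
have Rwr : R (w * r) by apply: RM.
have GE := inG_E23 Rr; have GE' := inG_E23 Rwr.
pose d := diag (cu x) (cv x).
pose n := nil_mx (ca x / cu x) (cb x / cv x) (cc x) (cp x / cv x) (cq x).
have Gd : inG d by inG_tac.
have Gn : inG n by apply: inG_nil => //; apply: RM => //; apply: U_inv.
have xE : x = n ** d.
  apply: coords_eq; split=> /=; rewrite ?mul1r //.
  by split; rewrite ?mulr0 ?add0r ?divfK.
have [nu nv] := (psi_unip Gn).1 (conj erefl erefl).
have dE : d ** E23 r = E23 (w * r) ** d.
  apply: coords_eq => /=; rewrite wE.
  by split; [ring|ring|split; ring].
have [Eu Ev] := psi_E23_unip Rr; have [Eu' Ev'] := psi_E23_unip Rwr.
have := (psi_rel Gd GE GE' Gd).2 dE; move/(congr1 (@cb K)) => /=.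
rewrite Ev Eu' mulr1 mul1r addrC => /addrI.
by rewrite [psi x](_ : _ = psi n ** psi d) /= -?psiM ?nu ?nv ?mul1r -?xE.
Qed.

End CoordGroup.

(** * Passage between matrices and coordinates *)

Local Notation "x ** y" := (cmul x y) (at level 40, left associativity).
Local Notation o0 := (inord 0 : 'I_4).
Local Notation o1 := (inord 1 : 'I_4).
Local Notation o2 := (inord 2 : 'I_4).
Local Notation o3 := (inord 3 : 'I_4).

Definition coords_of (K : Type) (A : 'M[K]_4) : coords K :=
  Coords (A o1 o1) (A o2 o2) (A o0 o1) (A o1 o2) (A o2 o3) (A o0 o2) (A o1 o3).

Definition mx_of (K : fieldType) (x : coords K) : 'M[K]_4 :=
  \matrix_(i, j) nth 0 (nth [::]
    [:: [:: 1; ca x; cp x; 0]; [:: 0; cu x; cb x; cq x];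
        [:: 0; 0; cv x; cc x]; [:: 0; 0; 0; 1]] i) j.

Lemma ord4P (i : 'I_4) : [\/ i = o0, i = o1, i = o2 | i = o3].
Proof.
case: i => [[|[|[|[|//]]]] ?].
- by apply: Or41; apply: val_inj; rewrite /= inordK.
- by apply: Or42; apply: val_inj; rewrite /= inordK.
- by apply: Or43; apply: val_inj; rewrite /= inordK.
- by apply: Or44; apply: val_inj; rewrite /= inordK.
Qed.

Lemma sum4 (V : nmodType) (F : 'I_4 -> V) :
  \sum_(i < 4) F i = F o0 + F o1 + F o2 + F o3.
Proof.
rewrite !big_ord_recl big_ord0 addr0 !addrA.
by congr (F _ + F _ + F _ + F _); apply: val_inj; rewrite /= inordK.
Qed.

Lemma mx_ofK (K : fieldType) (x : coords K) : coords_of (mx_of x) = x.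
Proof. by apply: coords_eq; rewrite /= !mxE !inordK. Qed.

Section UpperTriangular.
Variable K : fieldType.
Implicit Types A B N : 'M[K]_4.

Definition upper1 A : Prop :=
  (forall i j : 'I_4, (j < i)%N -> A i j = 0) /\ A o0 o0 = 1 /\ A o3 o3 = 1.

Lemma upper1_low A : upper1 A ->
  (A o1 o0 = 0) * (A o2 o0 = 0) * (A o3 o0 = 0) * (A o2 o1 = 0) *
  (A o3 o1 = 0) * (A o3 o2 = 0) * (A o0 o0 = 1) * (A o3 o3 = 1).
Proof. by case=> low [-> ->]; rewrite !low ?inordK. Qed.

Lemma coords_ofM A B : upper1 A -> upper1 B ->
  coords_of (A *m B) = coords_of A ** coords_of B.
Proof.
move=> /upper1_low lA /upper1_low lB; apply: coords_eq.
rewrite /= !mxE !sum4 !lA !lB !(mul0r, mulr0, mul1r, mulr1, add0r, addr0).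
by split=> //; split=> //; rewrite addrC.
Qed.

Lemma upper1M A B : upper1 A -> upper1 B -> upper1 (A *m B).
Proof.
move=> UA UB; have [lA _] := UA; have [lB _] := UB.
split; last by rewrite !mxE !sum4 !(upper1_low UA) !(upper1_low UB) !(mul0r, mulr0, mul1r, add0r, addr0).
move=> i j ji; rewrite mxE big1 // => k _.
have [ki|ik] := ltnP k i; first by rewrite lA ?mul0r.
by rewrite lB ?mulr0 // (leq_trans ji).
Qed.

Lemma upper1_unit A : upper1 A -> A o1 o1 != 0 -> A o2 o2 != 0 -> A \in unitmx.
Proof.
move=> UA u0 v0; rewrite unitmxE -det_tr det_trig.
  rewrite unitfE prodf_seq_neq0; apply/allP => i _; rewrite mxE /=.
  by case: (ord4P i) => ->; rewrite ?(upper1_low UA) ?oner_neq0.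
by apply/is_trig_mxP=> i j ij; rewrite mxE; case: UA => low _; rewrite low.
Qed.

Lemma center_mulE r N i j :
  ((1%:M + r *: delta_mx o0 o3) *m N) i j = N i j + r * (i == o0)%:R * N o3 j.
Proof.
rewrite mulmxDl mul1mx -scalemxAl !mxE sum4 !mxE -!val_eqE /= !inordK //=.
by rewrite andbF !andbT !mul0r !add0r mulrA.
Qed.

Lemma coords_of_center r N : upper1 N ->
  coords_of ((1%:M + r *: delta_mx o0 o3) *m N) = coords_of N.
Proof.
move=> UN; apply: coords_eq; rewrite /= !center_mulE !(upper1_low UN).
have ne k : (0 < k < 4)%N -> (inord k == o0 :> 'I_4) = false.
  by move=> /andP[k0 k4]; rewrite -val_eqE /= !inordK // gtn_eqF.
by rewrite (ne 1%N) // (ne 2%N) // !(mulr0, mul0r, addr0).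
Qed.

(** Moving [M] to the other side turns twisted conjugacy into an equation of products, so inverses
    need no coordinates. *)
Lemma coords_of_div r A N M : upper1 N -> N \in unitmx -> M \in unitmx ->
  A *m invmx (N *m invmx M) = 1%:M + r *: delta_mx o0 o3 ->
  coords_of (A *m M) = coords_of N.
Proof.
move=> UN uN uM E; have uC : N *m invmx M \in unitmx.
  by rewrite unitmx_mul uN unitmx_inv.
by rewrite -[A](mulmxKV uC) E -mulmxA mulmxKV // coords_of_center.
Qed.

Lemma coords_of_inj A B : upper1 A -> upper1 B -> coords_of A = coords_of B ->
  A = (1%:M + (A o0 o3 - B o0 o3) *: delta_mx o0 o3) *m B.
Proof.
move=> UA UB [E1 E2 E3 E4 E5 E6 E7]; apply/matrixP=> i j; rewrite center_mulE.
have ne k : (0 < k < 4)%N -> (inord k == o0 :> 'I_4) = false.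
  by move=> /andP[k0 k4]; rewrite -val_eqE /= !inordK // gtn_eqF.
case: (ord4P i) => ->; case: (ord4P j) => ->;
  rewrite ?eqxx ?(ne 1%N) ?(ne 2%N) ?(ne 3%N) // ?(upper1_low UA) ?(upper1_low UB) ?E1 ?E2 ?E3 ?E4 ?E5 ?E6 ?E7;
  by rewrite ?mulr0 ?mul0r ?mulr1 ?addr0 // addrC subrK.
Qed.

End UpperTriangular.

Section Quotient.
Variable f : P2.
Hypothesis irr_f : irreducible_poly f.

Lemma char2_K2 (x : K2) : x + x = 0.
Proof.
rewrite -[x]mul1r -mulrDl -frac21 -frac2D -polyCD.
by rewrite (_ : 1 + 1 = 0 :> 'F_2) ?mul0r ?tofrac0 //; apply: val_inj.
Qed.

Local Notation inG := (inG (inRf f)).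

Lemma inA4_upper1 A : inA4 f A -> upper1 A.
Proof. by case=> _ [low [A0 [A3 _]]]. Qed.

Lemma inA4_unit A : inA4 f A -> A \in unitmx.
Proof.
move=> GA; apply: upper1_unit; first exact: inA4_upper1.
  by case: GA => _ [_ [_ [_ [Uu _]]]]; apply: unitRf_neq0 Uu.
by case: GA => _ [_ [_ [_ [_ Uv]]]]; apply: unitRf_neq0 Uv.
Qed.

Lemma inA4_coords A : inA4 f A -> inG (coords_of A).
Proof. by case=> RA [_ [_ [_ [Uu Uv]]]]; split=> //; split; apply: RA. Qed.

Lemma inA4_mx_of x : inG x -> inA4 f (mx_of x).
Proof.
have r0 := inRf0 f; have r1 := inRf1 f.
case=> Uu Uv [Ra Rb Rc Rp Rq]; split.
  move=> i j; case: (ord4P i) => ->; case: (ord4P j) => ->; rewrite mxE !inordK //=.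
    by case: Uu.
  by case: Uv.
split; last by rewrite !mxE !inordK.
by move=> i j; case: (ord4P i) => ->; case: (ord4P j) => ->; rewrite mxE !inordK.
Qed.

Lemma inA4M A B : inA4 f A -> inA4 f B -> inA4 f (A *m B).
Proof.
move=> GA GB; have UA := inA4_upper1 GA; have UB := inA4_upper1 GB.
have [low [m0 m3]] := upper1M UA UB.
have [RA [_ [_ [_ [uA vA]]]]] := GA; have [RB [_ [_ [_ [uB vB]]]]] := GB.
split; first by move=> i j; rewrite mxE sum4; do 3?[apply: inRfD => //]; apply: inRfM.
split=> //; split=> //; split=> //.
have [-> -> _ _ _ _ _] := coords_ofM UA UB.
by split; apply: unitRfM.
Qed.

Lemma qeqP A B : inA4 f A -> inA4 f B ->
  qeq f A B <-> coords_of A = coords_of B.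
Proof.
move=> GA GB; have UA := inA4_upper1 GA; have UB := inA4_upper1 GB.
have uB := inA4_unit GB; split=> [[r [_ E]]|E].
  by rewrite -[A](mulmxKV uB) E coords_of_center.
exists (A o0 o3 - B o0 o3); split; last first.
  by rewrite {1}(coords_of_inj UA UB E) mulmxK.
rewrite char2_opp; last exact: char2_K2.
by case: GA => RA _; case: GB => RB _; apply: inRfD.
Qed.

Lemma qeq_mulV A N M : inA4 f N -> inA4 f M ->
  qeq f A (N *m invmx M) -> coords_of (A *m M) = coords_of N.
Proof.
move=> GN GM [r [_ E]].
exact: (coords_of_div (inA4_upper1 GN) (inA4_unit GN) (inA4_unit GM) E).
Qed.

End Quotient.

(** * Automorphisms and twisted conjugacy *)

Section AdditiveMap.
Variables (f : P2) (h : K2 -> K2).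
Hypotheses (irr_f : irreducible_poly f) (f_neqX : f != 'X).
Hypothesis nsr_f : ~ self_reciprocal f.
Hypothesis hR : forall r, inRf f r -> inRf f (h r).
Hypothesis hD : forall r r', inRf f r -> inRf f r' -> h (r + r') = h r + h r'.
Hypothesis h1 : h 1 != 0.
Hypothesis h_surj : forall r, inRf f r -> exists2 r', inRf f r' & h r' = r.
Hypothesis h_unit : forall w, unitRf f w -> exists2 w', unitRf f w' &
  forall r, inRf f r -> h (w * r) = w' * h r.

(* [h / h 1] is a ring automorphism of R_f, determined by the image of t. *)
Lemma additive_semilinear_linear r : inRf f r -> h r = r * h 1.
Proof.
have [tau utau htau] := h_unit (unitRf_t f).
have [phi uphi hphi] := h_unit (unitRf_f irr_f).
have h0 : h 0 = 0.
  by apply: (addrI (h 0)); rewrite -hD ?addr0 //; exact: inRf0.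
(* Additivity and [h (t r) = tau h r] suffice, by Horner's scheme. *)
have hP P : h (frac2 P) = horner2 P tau * h 1.
  elim/poly_ind: P => [|P c IHP].
    by rewrite horner2E map_poly0 horner0 [frac2 0]tofrac0 h0 mul0r.
  rewrite horner2_MXaddC frac2D hD; try exact: inRf_frac2.
  rewrite mulrDl; congr (_ + _).
    rewrite [P * 'X]mulrC frac2M htau; last exact: inRf_frac2.
    by rewrite IHP mulrCA mulrA.
  case: (F2_cases c) => ->; first by rewrite [frac2 _]tofrac0 h0 mul0r.
  by rewrite [frac2 _]frac21 mul1r.
have phiE : phi = horner2 f tau.
  apply: (mulIf h1); rewrite -hP -(hphi 1) ?mulr1 //; exact: inRf1.
have hX w w' n x : inRf f w -> (forall r, inRf f r -> h (w * r) = w' * h r) ->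
    inRf f x -> h (w ^+ n * x) = w' ^+ n * h x.
  move=> Rw hw; elim: n x => [|n IHn] x Rx; first by rewrite !mul1r.
  rewrite exprSr -mulrA IHn; last exact: inRfM.
  by rewrite hw // mulrA -exprSr.
have hden P a b r' : r' = frac2 P / frac2 ('X ^+ a * f ^+ b) ->
    tau ^+ a * horner2 f tau ^+ b * h r' = horner2 P tau * h 1.
  move=> r'E; have Rr' : inRf f r' by exists P, a, b.
  rewrite -phiE -mulrA -hP.
  have [Rt _] := unitRf_t f; have [Rf _] := unitRf_f irr_f.
  have Rfb : inRf f (frac2 f ^+ b * r').
    by apply: inRfM => //; case: (unitRfX b (unitRf_f irr_f)).
  rewrite -(hX _ _ _ _ Rf hphi Rr') -(hX _ _ _ _ Rt htau Rfb) mulrA.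
  by rewrite -!frac2X -frac2M r'E [frac2 _ * _]mulrC divfK ?den_neq0.
(* A preimage of [t * h 1], with its denominator cleared by [hden], expresses [t] through [tau] as
   [unit_generator] requires. *)
have tauE : tau = t2.
  have [r' [P [a [b r'E]]] hr'] :
      exists2 r', inRf f r' & h r' = t2 * h 1.
    by apply: h_surj; apply: inRfM; [exact: inRf_frac2|apply: hR; exact: inRf1].
  apply: (unit_generator irr_f f_neqX nsr_f (a := a) (b := b) (P := P)) => //.
    by rewrite -phiE.
  by apply: (mulIf h1); rewrite -(hden _ _ _ _ r'E) hr' [t2 * (_ * _)]mulrC mulrA.
case=> P [a [b rE]]; have := hden _ _ _ _ rE.
rewrite tauE !horner2_t -!frac2X -frac2M => hr.
apply: (mulfI (den_neq0 irr_f a b)); rewrite hr rE mulrA; congr (_ * _).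
by rewrite mulrC divfK ?den_neq0.
Qed.

End AdditiveMap.

Section FieldIdentities.
Variable F : fieldType.
Implicit Types a b c u v h : F.

Lemma mulr_divK a b c : c != 0 -> a / c * b * c = a * b.
Proof. by move=> c0; rewrite mulrAC divfK. Qed.

Lemma cross_ratio u v u' v' h : v != 0 -> h != 0 ->
  u' * h = u / v * h * v' -> u' * v = u * v'.
Proof.
move=> v0 h0 E; apply: (mulIf h0); rewrite mulrAC E.
by rewrite mulrAC mulr_divK // mulrAC.
Qed.

Lemma torus_cancel u v u' v' a b : u != 0 -> v != 0 -> u' * v = u * v' ->
  a * u' = u * b -> 1 * v' = v * 1 -> a = b.
Proof.
rewrite mul1r mulr1 => u0 v0 + + v'E; rewrite v'E => /(mulIf v0) ->.
by rewrite mulrC => /(mulfI u0).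
Qed.

End FieldIdentities.

Lemma t2_expn_inj : injective (fun n => t2 ^+ n).
Proof.
move=> m n /=; rewrite -!frac2X => /frac2_inj /(congr1 (fun p : P2 => size p)).
by rewrite !size_polyXn => -[].
Qed.

(** Invariance of the character [u / v], cross-multiplied: with [w = u / v], equivariance at [r = 1]
    is compared with [bmap psi w = w * bmap psi 1]. *)
Lemma quot_aut_ratio (f : P2) phi A : irreducible_poly f -> f != 'X ->
  ~ self_reciprocal f -> quot_aut f phi -> inA4 f A ->
  cu (coords_of (phi A)) * cv (coords_of A) =
    cu (coords_of A) * cv (coords_of (phi A)).
Proof.
move=> irr_f f_neqX nsr_f [phiG [phiE [phiM phi_surj]]] GA.
pose psi x := coords_of (phi (mx_of x)).
pose G := inG (inRf f).
have mxG x : G x -> inA4 f (mx_of x) by exact: inA4_mx_of.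
have R0 := inRf0 f; have R1 := inRf1 f.
have RD := inRfD irr_f; have RM := @inRfM f.
have psiG x : G x -> G (psi x).
  by move=> Gx; apply/inA4_coords/phiG/mxG.
(* This makes [psi] independent of the representative chosen by [mx_of]. *)
have phi_cong C D : inA4 f C -> inA4 f D -> coords_of C = coords_of D <->
    coords_of (phi C) = coords_of (phi D).
  move=> GC GD; rewrite -(qeqP irr_f) // -(qeqP irr_f); try exact: phiG.
  exact: phiE.
have psi_coords C : inA4 f C -> psi (coords_of C) = coords_of (phi C).
  move=> GC; apply/(phi_cong _ _ (mxG _ (inA4_coords GC)) GC).
  by rewrite mx_ofK.
have psiM x y : G x -> G y -> psi (x ** y) = psi x ** psi y.
  move=> Gx Gy; have Mx := mxG _ Gx; have My := mxG _ Gy.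
  rewrite -[in LHS](mx_ofK x) -[in LHS](mx_ofK y).
  rewrite -(coords_ofM (inA4_upper1 Mx) (inA4_upper1 My)).
  rewrite psi_coords; last exact: inA4M.
  rewrite -(coords_ofM (inA4_upper1 (phiG _ Mx)) (inA4_upper1 (phiG _ My))).
  have Gxy := phiG _ (inA4M irr_f Mx My).
  have GxGy := inA4M irr_f (phiG _ Mx) (phiG _ My).
  exact/(qeqP irr_f Gxy GxGy)/phiM.
have psi_inj x y : G x -> G y -> psi x = psi y -> x = y.
  move=> Gx Gy E; have := (phi_cong _ _ (mxG _ Gx) (mxG _ Gy)).2 E.
  by rewrite !mx_ofK.
have psi_surj y : G y -> exists2 x, G x & psi x = y.
  move=> Gy; have [C [GC E]] := phi_surj _ (mxG _ Gy).
  exists (coords_of C); first exact: inA4_coords.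
  rewrite psi_coords // -[RHS]mx_ofK.
  exact/(qeqP irr_f (phiG _ GC) (mxG _ Gy)).
have Ut := unitRf_t f.
have t_neq1 : t2 != 1.
  by apply/eqP; rewrite -[t2]expr1 -(expr0 t2) => /t2_expn_inj.
have hE := bmap_equivariant R0 R1 RD RM char2_K2 psiG psiM psi_inj.
have h1 := bmap1_neq0 R0 R1 RD RM char2_K2 Ut t_neq1 psiG psiM psi_inj psi_surj.
have h_id : forall r, inRf f r -> bmap psi r = r * bmap psi 1.
  move=> r; apply: (additive_semilinear_linear irr_f f_neqX nsr_f) => {r} //.
  - exact: (bmapR R0 R1 psiG).
  - exact: (bmapD R0 R1 RD RM char2_K2 psiG psiM psi_inj).
  - exact: (bmap_surj R0 R1 RD RM char2_K2 Ut t_neq1 psiG psiM psi_inj psi_surj).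
  move=> w Uw; have Gx : G (Coords w 1 0 0 0 0 0) by split=> //; exact: unitRf1.
  have [Uu Uv _] := psiG _ Gx.
  exists (cu (psi (Coords w 1 0 0 0 0 0)) / cv (psi (Coords w 1 0 0 0 0 0))).
    by apply: unitRfM => //; apply: unitRf_inv.
  move=> r Rr; apply: (mulIf (unitRf_neq0 Uv)).
  rewrite -(hE _ w r Gx) /=; [|by case: Uw|by []|by rewrite mulr1].
  exact/esym/(mulr_divK _ _ (unitRf_neq0 Uv)).
have GA' := inA4_coords GA; have [UA VA _] := GA'.
have v0 := unitRf_neq0 VA.
have UW : unitRf f (cu (coords_of A) / cv (coords_of A)).
  by apply: unitRfM => //; apply: unitRf_inv.
have [RW _] := UW.
have := hE _ _ 1 GA' RW R1; rewrite divfK // psi_coords // mulr1 (h_id _ RW) => /(_ erefl).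
exact: cross_ratio.
Qed.

Theorem mainTheorem16 (f : {poly 'F_2}) :
  irreducible_poly f -> f != 'X -> ~ self_reciprocal f -> R_infty_A4modZ f.
Proof.
move=> irr_f f_neqX nsr_f phi phi_aut.
have GD n : inA4 f (mx_of (Coords (t2 ^+ n) 1 0 0 0 0 0)).
  apply: inA4_mx_of; split; [exact/unitRfX/unitRf_t|exact: unitRf1|].
  by split; exact: inRf0.
exists (fun n => mx_of (Coords (t2 ^+ n) 1 0 0 0 0 0)); split=> // m n neq_mn.
case=> X [GX]; have [phiG _] := phi_aut; have GpX := phiG _ GX.
(* The relation becomes [D_n * phi X = X * D_m]. Its [v] coordinate shows that [X] and [phi X] have
   equal [v], hence by [ratio] equal [u]; the [u] coordinate then gives [t^n = t^m]. *)
move/(qeq_mulV (inA4M irr_f GX (GD m)) GpX).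
rewrite (coords_ofM (inA4_upper1 (GD n)) (inA4_upper1 GpX)).
rewrite (coords_ofM (inA4_upper1 GX) (inA4_upper1 (GD m))).
have ratio := quot_aut_ratio irr_f f_neqX nsr_f phi_aut GX.
have UX : unitRf f (cu (coords_of X)) by case: (inA4_coords GX).
have VX : unitRf f (cv (coords_of X)) by case: (inA4_coords GX).
rewrite !mx_ofK => E; apply: neq_mn; apply/esym/t2_expn_inj => /=.
have uE := congr1 (@cu K2) E; have vE := congr1 (@cv K2) E.
exact: (torus_cancel (unitRf_neq0 UX) (unitRf_neq0 VX) ratio uE vE).
Qed.
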